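(* Let $(F,G)$ be a Frobenius pair of functors, $F:\mathcal{C}\to\mathcal{D}$ and $G:\mathcal{D}\to\mathcal{C}$. Let $\eta:1_{\mathcal C}\to GF$ and $\varepsilon:FG\to 1_{\mathcal D}$ be the unit and counit of the adjunction $(F,G)$ ($F$ left adjoint to $G$), and let $\zeta:1_{\mathcal D}\to FG$ and $\nu:GF\to 1_{\mathcal C}$ be the unit and counit of the adjunction $(G,F)$ ($G$ left adjoint to $F$). Then the following statements are equivalent: (a) $F$ is separable; (b) there exists a natural transformation $\alpha:F\to F$ such that $\nu_C\circ G(\alpha_C)\circ\eta_C=I_C$ for all $C\in\mathcal{C}$; (c) there exists a natural transformation $\beta:G\to G$ such that $\nu_C\circ\beta_{F(C)}\circ\eta_C=I_C$ for all $C\in\mathcal{C}$. Likewise, the following statements are equivalent: (a') $G$ is separable; (b') there exists a natural transformation $\alpha:F\to F$ such that $\varepsilon_D\circ\alpha_{G(D)}\circ\zeta_D=I_D$ for all $D\in\mathcal{D}$; (c') there exists a natural transformation $\beta:G\to G$ such that $\varepsilon_D\circ F(\beta_D)\circ\zeta_D=I_D$ for all $D\in\mathcal{D}$.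
   Context: A (covariant) functor $F:\mathcal{C}\to\mathcal{D}$ is separable if the natural transformation $\mathcal{F}:\mathrm{Hom}_{\mathcal C}(\bullet,\bullet)\to\mathrm{Hom}_{\mathcal D}(F(\bullet),F(\bullet))$, $\mathcal{F}_{C,C'}(f)=F(f)$, splits, i.e. there is a natural transformation $\mathcal{P}:\mathrm{Hom}_{\mathcal D}(F(\bullet),F(\bullet))\to\mathrm{Hom}_{\mathcal C}(\bullet,\bullet)$ with $\mathcal{P}\circ\mathcal{F}$ the identity. A pair $(F,G)$ is a Frobenius pair if $G$ is both a right adjoint and a left adjoint of $F$. $I_X$ denotes the identity morphism of $X$. *)

(* Defs.v *)
(* Categories are not assumed small: objects and morphisms live in two
   arbitrary universes, and morphisms are compared with Leibniz equality. *)
From Stdlib Require Import FunctionalExtensionality.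

Set Implicit Arguments.
Unset Strict Implicit.
Unset Printing Implicit Defensive.

Declare Scope cat_scope.
Delimit Scope cat_scope with cat.
Local Open Scope cat_scope.

Record category := Category {
  obj :> Type;
  hom : obj -> obj -> Type;
  idm : forall x, hom x x;
  comp : forall x y z, hom y z -> hom x y -> hom x z;
  comp_idl : forall x y (f : hom x y), comp (idm y) f = f;
  comp_idr : forall x y (f : hom x y), comp f (idm x) = f;
  compA : forall x y z t (h : hom z t) (g : hom y z) (f : hom x y),
    comp h (comp g f) = comp (comp h g) f
}.

Arguments hom {c} x y.
Arguments idm {c} x.
Arguments comp {c x y z} g f.
Notation "g ∘ f" := (comp g f) (at level 40, left associativity) : cat_scope.

Record functor (C D : category) := Functor {
  fobj :> C -> D;
  fmap : forall x y : C, hom x y -> hom (fobj x) (fobj y);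
  fmap_id : forall x, fmap (idm x) = idm (fobj x);
  fmap_comp : forall x y z (g : hom y z) (f : hom x y),
    fmap (g ∘ f) = fmap g ∘ fmap f
}.

Arguments fmap {C D} F {x y} f : rename.

Record nat_trans (C D : category) (F G : functor C D) := NatTrans {
  component :> forall x : C, hom (F x) (G x);
  naturality : forall (x y : C) (f : hom x y),
    component y ∘ fmap F f = fmap G f ∘ component x
}.

Definition id_functor (C : category) : functor C C.
Proof.
refine (@Functor C C (fun x => x) (fun x y f => f) _ _); reflexivity.
Defined.

Definition comp_functor (C D E : category) (G : functor D E) (F : functor C D) :
  functor C E.
Proof.
refine (@Functor C E (fun x => G (F x)) (fun x y f => fmap G (fmap F f)) _ _).
- intros x; now rewrite !fmap_id.
- intros x y z g f; now rewrite !fmap_comp.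
Defined.

Definition op_category (C : category) : category.
Proof.
refine (@Category C (fun x y => @hom C y x) (@idm C)
          (fun x y z g f => @comp C z y x f g) _ _ _).
- intros; apply comp_idr.
- intros; apply comp_idl.
- intros; symmetry; apply compA.
Defined.

Definition prod_category (C D : category) : category.
Proof.
refine (@Category (C * D)%type
          (fun x y => (hom (fst x) (fst y) * hom (snd x) (snd y))%type)
          (fun x => (idm (fst x), idm (snd x)))
          (fun x y z g f => (fst g ∘ fst f, snd g ∘ snd f)) _ _ _).
- intros x y [f1 f2]; simpl; now rewrite !comp_idl.
- intros x y [f1 f2]; simpl; now rewrite !comp_idr.
- intros; simpl; now rewrite !compA.
Defined.

(* The role of the category of sets is played by types and functions. *)
Definition type_category : category.
Proof.
refine (@Category Type (fun A B => A -> B) (fun A a => a)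
          (fun A B E g f a => g (f a)) _ _ _); reflexivity.
Defined.

(* The functor F^op x F : C^op x C -> D^op x D *)
Definition op_prod_functor (C D : category) (F : functor C D) :
  functor (prod_category (op_category C) C) (prod_category (op_category D) D).
Proof.
refine (@Functor (prod_category (op_category C) C)
          (prod_category (op_category D) D)
          (fun x => (F (fst x), F (snd x)))
          (fun x y f => (@fmap C D F (fst y) (fst x) (fst f),
                         @fmap C D F (snd x) (snd y) (snd f))) _ _).
- intros x; simpl; now rewrite !fmap_id.
- intros; simpl; now rewrite !fmap_comp.
Defined.

(* Hom_C(-,-) : C^op x C -> Set, with (f, g) acting by h |-> g ∘ h ∘ f *)
Definition hom_functor (C : category) :
  functor (prod_category (op_category C) C) type_category.
Proof.
refine (@Functor (prod_category (op_category C) C) type_category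
          (fun x => @hom C (fst x) (snd x))
          (fun x y p (h : @hom C (fst x) (snd x)) =>
             @comp C (fst y) (fst x) (snd y) (snd p ∘ h) (fst p)) _ _).
- intros x; apply functional_extensionality; intros h; simpl.
  now rewrite comp_idl, comp_idr.
- intros x y z q p; apply functional_extensionality; intros h; simpl.
  now rewrite !compA.
Defined.

(* Hom_D(F(-),F(-)) : C^op x C -> Set *)
Definition hom_functor_along (C D : category) (F : functor C D) :
  functor (prod_category (op_category C) C) type_category :=
  comp_functor (hom_functor D) (op_prod_functor F).

(* f |-> F(f), as a transformation Hom_C(-,-) -> Hom_D(F(-),F(-)) *)
Definition fmap_nat_trans (C D : category) (F : functor C D) :
  nat_trans (hom_functor C) (hom_functor_along F).
Proof.
refine (@NatTrans _ _ (hom_functor C) (hom_functor_along F)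
          (fun x (f : @hom C (fst x) (snd x)) => fmap F f) _).
intros x y p; apply functional_extensionality; intros h; simpl.
now rewrite !fmap_comp.
Defined.

Definition separable (C D : category) (F : functor C D) : Prop :=
  exists P : nat_trans (hom_functor_along F) (hom_functor C),
    forall x, P x ∘ fmap_nat_trans F x = idm (hom_functor C x).

(* [adjunction F G]: F is left adjoint to G *)
Record adjunction (C D : category) (F : functor C D) (G : functor D C) :=
  Adjunction {
  adj_unit : nat_trans (id_functor C) (comp_functor G F);
  adj_counit : nat_trans (comp_functor F G) (id_functor D);
  adj_triangle_left : forall x : C,
    adj_counit (F x) ∘ fmap F (adj_unit x) = idm (F x);
  adj_triangle_right : forall y : D,
    fmap G (adj_counit y) ∘ adj_unit (G y) = idm (G y)
}.

(* The two adjunctions are kept as data, since their units and counits are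
   not determined by the functors. *)
Record frobenius_pair (C D : category) (F : functor C D) (G : functor D C) :=
  FrobeniusPair {
  frob_right_adj : adjunction F G;
  frob_left_adj : adjunction G F
}.

(* Main.v *)
From Stdlib Require Import ssreflect FunctionalExtensionality.
Require Import Defs.
Local Open Scope cat_scope.

(** Rafael's criterion: a left adjoint [F], with right adjoint [G], is separable
    exactly when its unit [eta : 1 -> GF] has a natural retraction
    [rho : GF -> 1].  Indeed [rho] is the image under the splitting of the counit
    at [F c], seen as a morphism [F (GF c) -> F c]; conversely [rho] yields the
    splitting [g |-> rho ∘ G g ∘ eta], the adjoint transpose of [g] followed by
    [rho].

    When [G] is also left adjoint to [F], with unit [zeta] and counit [nu], every
    [rho : GF -> 1] has the form [nu ∘ G alpha] with [alpha = F rho ∘ zeta F], and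
    also the form [nu ∘ beta F] with [beta = rho G ∘ G zeta]; the two triangle
    identities of the adjunction [(G, F)] give one form each
    ([counit_after_alpha_mate], [counit_after_beta_mate]).  Substituting them in
    Rafael's criterion, [separable_left_adjoint], gives the equivalences for [F].

    A Frobenius pair is a symmetric notion, and exchanging [F] with [G] exchanges
    [eta] with [zeta] and [nu] with the counit of [(F, G)], so the equivalences
    for [G] are those for [F] applied to the pair [(G, F)]. *)

Section Rafael.
Context {C D : category} {F : functor C D} {G : functor D C}.
Variable FG : adjunction F G.

Lemma adj_unit_natural (x y : C) (f : hom x y) :
  @comp C x y (G (F y)) (adj_unit FG y) f =
  @comp C x (G (F x)) (G (F y)) (fmap G (fmap F f)) (adj_unit FG x).
Proof. exact: (naturality (adj_unit FG) f). Qed.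

Lemma adj_counit_natural (x y : D) (g : hom x y) :
  @comp D (F (G x)) (F (G y)) y (adj_counit FG y) (fmap F (fmap G g)) =
  @comp D (F (G x)) x y g (adj_counit FG x).
Proof. exact: (naturality (adj_counit FG) g). Qed.

(** Naturality in the target comes from that of [rho], naturality in the source
    from that of the unit. *)
Definition splitting_of_retraction
    (rho : nat_trans (comp_functor G F) (id_functor C)) :
  nat_trans (hom_functor_along F) (hom_functor C).
Proof.
refine (@NatTrans _ _ (hom_functor_along F) (hom_functor C)
  (fun x (g : @hom D (F (fst x)) (F (snd x))) =>
     @comp C (fst x) (G (F (fst x))) (snd x)
       (@comp C (G (F (fst x))) (G (F (snd x))) (snd x) (rho (snd x)) (fmap G g))
       (adj_unit FG (fst x))) _).
move=> [x1 x2] [y1 y2] [u v]; apply: functional_extensionality => g /=.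
move: (naturality rho v) => /= rhov.
rewrite !fmap_comp !compA rhov -!compA; congr (_ ∘ (_ ∘ (_ ∘ _))).
by rewrite adj_unit_natural.
Defined.

(** Elementwise form of naturality, an equation in [C] that can be rewritten. *)
Lemma splitting_natural (P : nat_trans (hom_functor_along F) (hom_functor C))
    (x1 x2 y1 y2 : C) (u : hom y1 x1) (v : hom x2 y2) (g : hom (F x1) (F x2)) :
  P (y1, y2) (fmap F v ∘ g ∘ fmap F u) = v ∘ P (x1, x2) g ∘ u.
Proof.
exact: (f_equal (fun k => k g)
  (@naturality _ _ _ _ P (x1, x2) (y1, y2) (u, v))).
Qed.

Definition retraction_of_splitting
    (P : nat_trans (hom_functor_along F) (hom_functor C)) :
  nat_trans (comp_functor G F) (id_functor C).
Proof.
refine (@NatTrans _ _ (comp_functor G F) (id_functor C)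
  (fun c => P (G (F c), c) (adj_counit FG (F c))) _).
move=> x y f /=.
(* Both sides are the value of [P] at [eps ∘ FGF f = F f ∘ eps]. *)
have Pl := splitting_natural P (G (F x)) x (G (F x)) y (idm _) f
  (adj_counit FG (F x)).
have Pr := splitting_natural P (G (F y)) y (G (F x)) y (fmap G (fmap F f))
  (idm _) (adj_counit FG (F y)).
move: Pl Pr; rewrite !fmap_id !comp_idl !comp_idr => <- <-.
by rewrite adj_counit_natural.
Defined.

(** Naturality of [P] in the source turns [P eps ∘ eta] into [P (eps ∘ F eta)],
    which is [P (F id) = id] by a triangle identity. *)
Lemma separable_left_adjoint :
  separable F <->
  exists rho : nat_trans (comp_functor G F) (id_functor C),
    forall c, rho c ∘ adj_unit FG c = idm c.
Proof.
split=> [[P PK]|[rho rhoK]].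
- exists (retraction_of_splitting P) => c /=.
  have Pu := splitting_natural P (G (F c)) c c c (adj_unit FG c) (idm c)
    (adj_counit FG (F c)).
  move: Pu; rewrite fmap_id !comp_idl => <-.
  transitivity (P (c, c) (fmap F (idm c))).
    apply: (f_equal (P (c, c))).
    by rewrite fmap_id; exact: adj_triangle_left.
  exact: (f_equal (fun k => k (idm c)) (PK (c, c))).
- exists (splitting_of_retraction rho) => -[x y].
  apply: functional_extensionality => f /=.
  rewrite -compA -adj_unit_natural compA.
  by rewrite (rhoK y : @comp C y (G (F y)) y _ _ = _) comp_idl.
Qed.

End Rafael.

Section Mates.
Context {C D : category} {F : functor C D} {G : functor D C}.
Variable GF : adjunction G F.
Implicit Type rho : nat_trans (comp_functor G F) (id_functor C).

Definition counit_after_alpha (alpha : nat_trans F F) :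
  nat_trans (comp_functor G F) (id_functor C).
Proof.
refine (@NatTrans _ _ (comp_functor G F) (id_functor C)
  (fun c => @comp C (G (F c)) (G (F c)) c (adj_counit GF c)
              (fmap G (alpha c))) _).
move=> x y f /=.
by rewrite -compA -fmap_comp naturality fmap_comp !compA adj_counit_natural.
Defined.

Definition counit_after_beta (beta : nat_trans G G) :
  nat_trans (comp_functor G F) (id_functor C).
Proof.
refine (@NatTrans _ _ (comp_functor G F) (id_functor C)
  (fun c => @comp C (G (F c)) (G (F c)) c (adj_counit GF c) (beta (F c))) _).
move=> x y f /=.
by rewrite -compA naturality !compA adj_counit_natural.
Defined.

Definition alpha_mate rho : nat_trans F F.
Proof.
refine (@NatTrans _ _ F F
  (fun c => @comp D (F c) (F (G (F c))) (F c) (fmap F (rho c))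
              (adj_unit GF (F c))) _).
move=> x y f; move: (naturality rho f) => /= rhof.
by rewrite -compA adj_unit_natural compA -fmap_comp rhof fmap_comp -compA.
Defined.

Definition beta_mate rho : nat_trans G G.
Proof.
refine (@NatTrans _ _ G G
  (fun d => @comp C (G d) (G (F (G d))) (G d) (rho (G d))
              (fmap G (adj_unit GF d))) _).
move=> x y g; move: (naturality rho (fmap G g)) => /= rhog.
by rewrite -compA -fmap_comp adj_unit_natural fmap_comp !compA rhog.
Defined.

(** Naturality of the counit moves [rho] to the left of [nu]; what remains is the
    triangle identity at [F c] in [C]. *)
Lemma counit_after_alpha_mate rho (c : C) :
  counit_after_alpha (alpha_mate rho) c = rho c.
Proof.
rewrite /= fmap_comp compA adj_counit_natural -compA.
by rewrite (adj_triangle_left GF (F c)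
  : @comp C (G (F c)) (G (F (G (F c)))) (G (F c)) _ _ = _) comp_idr.
Qed.

(** Here naturality of [rho] along [nu] is used, which brings [zeta] against
    [F nu]: the other triangle identity. *)
Lemma counit_after_beta_mate rho (c : C) :
  counit_after_beta (beta_mate rho) c = rho c.
Proof.
move: (naturality rho (adj_counit GF c)) => /= rhonu.
rewrite /= compA -rhonu -compA -fmap_comp.
by rewrite (adj_triangle_right GF c
  : @comp D (F c) (F (G (F c))) (F c) _ _ = _) fmap_id comp_idr.
Qed.

End Mates.

(** Rafael's criterion with the retraction written in either of its two forms. *)
Lemma frobenius_separable_left {C D : category} {F : functor C D}
    {G : functor D C} (FG : adjunction F G) (GF : adjunction G F) :
  (separable F <->
    exists alpha : nat_trans F F, forall c : C,
      adj_counit GF c ∘ fmap G (alpha c) ∘ adj_unit FG c = idm c) /\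
  (separable F <->
    exists beta : nat_trans G G, forall c : C,
      adj_counit GF c ∘ beta (F c) ∘ adj_unit FG c = idm c).
Proof.
have [to_rho of_rho] := separable_left_adjoint FG; split; split.
- move=> /to_rho [rho rhoK]; exists (alpha_mate GF rho) => c.
  by rewrite -[RHS]rhoK -(counit_after_alpha_mate GF rho).
- move=> [alpha alphaK]; apply: of_rho.
  by exists (counit_after_alpha GF alpha).
- move=> /to_rho [rho rhoK]; exists (beta_mate GF rho) => c.
  by rewrite -[RHS]rhoK -(counit_after_beta_mate GF rho).
- move=> [beta betaK]; apply: of_rho.
  by exists (counit_after_beta GF beta).
Qed.

Theorem proposition5p4 (C D : category) (F : functor C D) (G : functor D C)
    (FG : frobenius_pair F G) :
  let eta : nat_trans (id_functor C) (comp_functor G F) :=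
    adj_unit (frob_right_adj FG) in
  let eps : nat_trans (comp_functor F G) (id_functor D) :=
    adj_counit (frob_right_adj FG) in
  let zeta : nat_trans (id_functor D) (comp_functor F G) :=
    adj_unit (frob_left_adj FG) in
  let nu : nat_trans (comp_functor G F) (id_functor C) :=
    adj_counit (frob_left_adj FG) in
  ((separable F <->
      exists alpha : nat_trans F F,
        forall c : C, nu c ∘ fmap G (alpha c) ∘ eta c = idm c) /\
   (separable F <->
      exists beta : nat_trans G G,
        forall c : C, nu c ∘ beta (F c) ∘ eta c = idm c)) /\
  ((separable G <->
      exists alpha : nat_trans F F,
        forall d : D, eps d ∘ alpha (G d) ∘ zeta d = idm d) /\
   (separable G <->
      exists beta : nat_trans G G,
        forall d : D, eps d ∘ fmap F (beta d) ∘ zeta d = idm d)).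
Proof.
move=> eta eps zeta nu; split.
- exact: (frobenius_separable_left (frob_right_adj FG) (frob_left_adj FG)).
(* Exchanging [F] and [G] turns transformations of [G] into the [alpha] of the
   pair, so the two equivalences come out in the opposite order. *)
- by case: (frobenius_separable_left (frob_left_adj FG) (frob_right_adj FG)).
Qed.
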